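(* Let $j\in\{1,\dots,q\}$, real $\eta$ with $|\eta|\le\eta_0$, $T-\eta_0>y>0$, and $0<\delta\le\frac12$. Then for any real $\tilde\eta$ with $|\tilde\eta|\le\eta_0$, as $T\to\infty$, $$\int_\alpha^\beta\phi^{(\kappa_j)}_{T,\eta}(x+iy,0)\,dx=\int_\alpha^\beta\varphi^{(\kappa_j)}_{T,\tilde\eta}(x+iy,0)\,dx+O\big(T^{-\delta}\big),$$ so long as $\beta-\alpha$ remains bounded and $\beta-\alpha> T^{-3/4+\delta}$. The implied constant depends only on $h$, $\kappa_1$, $\kappa_j$ (and $\Gamma$) and an upper bound for $\beta-\alpha$.
   Context: Let $G=\mathrm{PSL}_2(\mathbb R)$ act on $\mathbb H=\{z=x+iy:y>0\}$ and on $T^1\mathbb H\cong\mathbb H\times\mathbb R/2\pi\mathbb Z$ by $\gamma(z,\theta)=\big(\tfrac{az+b}{cz+d},\theta-2\arg(cz+d)\big)$ for $\gamma=\pm\begin{pmatrix}a&b\\c&d\end{pmatrix}$. Let $\Gamma\subset G$ be a non-cocompact Fuchsian group of finite covolume with a complete set of inequivalent cusps $\kappa_1,\dots,\kappa_q$ and stabilizers $\Gamma_1,\dots,\Gamma_q$, normalized so that $\kappa_1=\infty$ and $\Gamma_1=\Gamma_\infty=\{\begin{pmatrix}1&b\\0&1\end{pmatrix}:b\in\mathbb Z\}$. For each $j$ fix a scaling matrix $\sigma_j\in G$ with $\sigma_j\infty=\kappa_j$, $\sigma_j^{-1}\Gamma_j\sigma_j=\Gamma_\infty$, $\sigma_1=\mathrm{id}$,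 chosen so that for a canonical fundamental domain $F\subset[0,1]\times(0,\infty)$ and a constant $B_0>1$ depending on $\Gamma$ one has $\sigma_j^{-1}(\overline F)\cap\{y\ge B\}=[0,1]\times[B,\infty)$ for all $B\ge B_0$ and all $j$. Fix $B_1>B_0$ and set $\eta_0=\min\{(B_1-B_0)/2,1/4\}$. Let $h:\mathbb R/\mathbb Z\times\mathbb R/2\pi\mathbb Z\to\mathbb C$ be $C^\infty$. Let $\rho(x)=\ell^{-1}e^{-1/(1-x^2)}$ for $|x|<1$ and $\rho(x)=0$ for $|x|\ge1$, where $\ell=\int_{-1}^1e^{-1/(1-x^2)}dx$, and $\rho_\varepsilon(x)=\varepsilon^{-1}\rho(x/\varepsilon)$. For $T\ge B_1$ and real $\eta$ with $|\eta|\le\eta_0$, let $\mathbb 1_{[T,\infty),0}$ be the indicator function of $[T,\infty)$ on $(0,\infty)$, and for $\eta\ne0$ let $\mathbb 1_{[T,\infty),\eta}(y)=(\mathbb 1_{[-T+\eta/2,\infty)}*\rho_{|\eta|/2})(y-2T)$ (a smooth $[0,1]$-valued function equal to $0$ for $y\le\min(T,T+\eta)$ and to $1$ for $y\ge\max(T,T+\eta)$). Define $f_{T,\eta}(z,\theta)=\mathbb 1_{[T,\infty),\eta}(y)\,h(x,\theta)$ and the automorphic function $\phi^{(\kappa_j)}_{T,\eta}(z,\theta)=\sum_{\gamma\in\Gamma_j\backslash\Gamma}f_{T,\eta}(\sigma_j^{-1}\gamma(z,\theta))$. Define also $g_{T,\eta}(z,\theta)=\mathbb 1_{[T,\infty),\eta}(y)\int_0^1h(t,\theta)\,dt$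 and $\varphi^{(\kappa_j)}_{T,\eta}(z,\theta)=\sum_{\gamma\in\Gamma_j\backslash\Gamma}g_{T,\eta}(\sigma_j^{-1}\gamma(z,\theta))$. *)

(* Defs.v *)
(* MathComp + MathComp-Analysis (R : realType), complex numbers R[i]
   from mathcomp-real-closed.  Points of the upper half plane are z : R[i]
   with complex.Im z > 0; elements of PSL_2(R) are represented by their preimages in
   SL_2(R), i.e. 2x2 real matrices of determinant 1, and a Fuchsian group is
   represented by its full preimage in SL_2(R) (a subgroup containing -1). *)
From HB Require Import structures.
From mathcomp Require Import all_boot all_order all_algebra.
From mathcomp Require Import all_classical all_reals all_analysis.
From mathcomp Require Import complex.
From Stdlib Require Import ClassicalEpsilon.
Set Implicit Arguments. Unset Strict Implicit. Unset Printing Implicit Defensive.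
Import Order.TTheory GRing.Theory Num.Theory.
Import numFieldNormedType.Exports.
Local Open Scope classical_set_scope.
Local Open Scope ring_scope.
Local Open Scope complex_scope.

Section Defs.
Variable R : realType.

Definition ma (A : 'M[R]_2) : R := A 0 0.
Definition mb (A : 'M[R]_2) : R := A 0 1.
Definition mc (A : 'M[R]_2) : R := A 1 0.
Definition md (A : 'M[R]_2) : R := A 1 1.

Definition mk2 (a b c d : R) : 'M[R]_2 :=
  \matrix_(i < 2, k < 2) (if i == 0 then (if k == 0 then a else b)
                          else (if k == 0 then c else d)).

Definition cabs (w : R[i]) : R := Num.sqrt (complex.Re w ^+ 2 + complex.Im w ^+ 2).

(* principal argument of w in (-pi, pi] (arg 0 := 0) *)
Definition carg (w : R[i]) : R :=
  let x := complex.Re w in let y := complex.Im w in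
  if 0 < x then atan (y / x)
  else if x < 0 then (if 0 <= y then atan (y / x) + pi else atan (y / x) - pi)
  else if 0 < y then pi / 2 else if y < 0 then - (pi / 2) else 0.

Definition pt (p : R * R) : R[i] := p.1 +i* p.2.

Definition mob (A : 'M[R]_2) (z : R[i]) : R[i] :=
  ((ma A)%:C * z + (mb A)%:C) / ((mc A)%:C * z + (md A)%:C).

(* action on T^1 H = H x R/2piZ : gamma (z, theta) = (gamma z, theta - 2 arg(cz+d)) *)
Definition act1 (A : 'M[R]_2) (p : R[i] * R) : R[i] * R :=
  (mob A p.1, p.2 - 2 * carg ((mc A)%:C * p.1 + (md A)%:C)).

(* action on the boundary R u {oo}; None stands for oo *)
Definition act_bd (A : 'M[R]_2) (k : option R) : option R :=
  match k with
  | None => if mc A == 0 then None else Some (ma A / mc A)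
  | Some x => if mc A * x + md A == 0 then None
              else Some ((ma A * x + mb A) / (mc A * x + md A))
  end.

(* G (a set of matrices) is the preimage in SL_2(R) of a discrete subgroup of
   PSL_2(R) *)
Definition fuchsian (G : set 'M[R]_2) : Prop :=
  [/\ (forall A, G A -> \det A = 1),
      G 1 /\ G (-1),
      (forall A B, G A -> G B -> G (A *m B)),
      (forall A, G A -> G (invmx A)) &
      exists e : R, 0 < e /\ forall A, G A ->
        (forall i k, `|A i k - (1 : 'M[R]_2) i k| < e) -> A = 1].

Definition Fbar (F : set (R * R)) : set (R * R) :=
  closure F `&` [set p | 0 < p.2].

Definition fund_domain (G : set 'M[R]_2) (F : set (R * R)) : Prop :=
  [/\ open F, F `<=` [set p | 0 < p.2],
      (forall p p' A, F p -> F p' -> G A -> mob A (pt p) = pt p' -> p = p') &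
      (forall z, 0 < complex.Im z -> exists A p, [/\ G A, Fbar F p & mob A z = pt p])].

Definition hyp_area (F : set (R * R)) : \bar R :=
  (\int[(@lebesgue_measure R \x @lebesgue_measure R)%E]_(p in F)
     ((p.2 ^- 2)%:E))%E.

Definition parabolic (A : 'M[R]_2) : Prop :=
  (\tr A = 2 \/ \tr A = -2) /\ A <> 1 /\ A <> -1.

Definition is_cusp (G : set 'M[R]_2) (k : option R) : Prop :=
  exists A, [/\ G A, parabolic A & act_bd A k = k].

Definition cusp_equiv (G : set 'M[R]_2) (k k' : option R) : Prop :=
  exists A, G A /\ act_bd A k = k'.

Definition complete_cusps (G : set 'M[R]_2) (q : nat) (kappa : nat -> option R) :=
  [/\ (1 <= q)%N,
      (forall j, (1 <= j <= q)%N -> is_cusp G (kappa j)),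
      (forall i j, (1 <= i <= q)%N -> (1 <= j <= q)%N ->
          cusp_equiv G (kappa i) (kappa j) -> i = j) &
      (forall k, is_cusp G k -> exists2 j, (1 <= j <= q)%N & cusp_equiv G k (kappa j))].

Definition stab (G : set 'M[R]_2) (kappa : nat -> option R) (j : nat) : set 'M[R]_2 :=
  [set A | G A /\ act_bd A (kappa j) = kappa j].

Definition Ginf : set 'M[R]_2 :=
  [set A | exists b : int, A = mk2 1 b%:~R 0 1 \/ A = mk2 (-1) (- b%:~R) 0 (-1)].

Definition scaling_data (G : set 'M[R]_2) (q : nat) (kappa : nat -> option R)
    (sigma : nat -> 'M[R]_2) :=
  [/\ kappa 1%N = None, stab G kappa 1 = Ginf, sigma 1%N = 1 &
      forall j, (1 <= j <= q)%N ->
        [/\ \det (sigma j) = 1, act_bd (sigma j) None = kappa j &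
            [set invmx (sigma j) *m A *m sigma j | A in stab G kappa j] = Ginf]].

Definition cusp_normalization (F : set (R * R)) (q : nat) (sigma : nat -> 'M[R]_2)
    (B0 : R) :=
  forall j, (1 <= j <= q)%N -> forall B, B0 <= B ->
    [set mob (invmx (sigma j)) (pt p) | p in Fbar F] `&` [set w | B <= complex.Im w]
    = [set w | 0 <= complex.Re w <= 1 /\ B <= complex.Im w].

(* C^oo on R^2: all iterated partial derivatives exist and are continuous *)
Definition smooth2 (g : R -> R -> R) : Prop :=
  exists S : set (R -> R -> R), S g /\ forall u, S u ->
    [/\ continuous (fun p : R * R => u p.1 p.2),
        (forall x t, derivable (fun s => u s t) x 1),
        (forall x t, derivable (u x) t 1),
        S (fun x t => derive1 (fun s => u s t) x) &
        S (fun x t => derive1 (u x) t)].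

(* h : R/Z x R/2piZ -> C smooth, viewed as a periodic function on R^2 *)
Definition smooth_torus_fun (h : R -> R -> R[i]) : Prop :=
  [/\ (forall x t, h (x + 1) t = h x t),
      (forall x t, h x (t + 2 * pi) = h x t),
      smooth2 (fun x t => complex.Re (h x t)) &
      smooth2 (fun x t => complex.Im (h x t))].

Definition cint (f : R -> R[i]) (a b : R) : R[i] :=
  Rintegral (@lebesgue_measure R) `[a, b] (fun x => complex.Re (f x)) +i*
  Rintegral (@lebesgue_measure R) `[a, b] (fun x => complex.Im (f x)).

Definition ell : R :=
  Rintegral (@lebesgue_measure R) `]-1, 1[ (fun x => expR (- (1 - x ^+ 2)^-1)).

Definition rho (x : R) : R :=
  if `|x| < 1 then ell^-1 * expR (- (1 - x ^+ 2)^-1) else 0.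

Definition rho_eps (e x : R) : R := e^-1 * rho (x / e).

Definition ind_ge (a y : R) : R := if a <= y then 1 else 0.

Definition sind (T eta y : R) : R :=
  if eta == 0 then ind_ge T y
  else
    Rintegral (@lebesgue_measure R) setT
      (fun s => ind_ge (- T + eta / 2) (y - 2 * T - s) * rho_eps (`|eta| / 2) s).

Definition f_T (h : R -> R -> R[i]) (T eta : R) (p : R[i] * R) : R[i] :=
  (sind T eta (complex.Im p.1))%:C * h (complex.Re p.1) p.2.

Definition g_T (h : R -> R -> R[i]) (T eta : R) (p : R[i] * R) : R[i] :=
  (sind T eta (complex.Im p.1))%:C * cint (fun t => h t p.2) 0 1.

Definition transversal (G H S : set 'M[R]_2) : Prop :=
  S `<=` G /\ forall A, G A -> exists! s, S s /\ exists2 g, H g & A = g *m s.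

Definition transv (G H : set 'M[R]_2) : set 'M[R]_2 :=
  epsilon (inhabits set0) (transversal G H).

Definition eisen (G : set 'M[R]_2) (kappa : nat -> option R) (sigma : nat -> 'M[R]_2)
    (j : nat) (u : R[i] * R -> R[i]) (p : R[i] * R) : R[i] :=
  \sum_(s \in transv G (stab G kappa j)) u (act1 (invmx (sigma j)) (act1 s p)).

Definition phi G kappa sigma h j T eta := eisen G kappa sigma j (f_T h T eta).
Definition varphi G kappa sigma h j T eta := eisen G kappa sigma j (g_T h T eta).

Definition eta0 (B0 B1 : R) : R := Num.min ((B1 - B0) / 2) (1 / 4).

End Defs.

(* Main.v *)
Require Import Defs.
From HB Require Import structures.
From mathcomp Require Import all_boot all_order all_algebra.
From mathcomp Require Import all_classical all_reals all_analysis.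
From mathcomp Require Import complex.
From mathcomp Require Import ring lra.
Import Order.TTheory GRing.Theory Num.Theory.
Import numFieldNormedType.Exports.
Local Open Scope classical_set_scope.
Local Open Scope ring_scope.
Local Open Scope complex_scope.

(* Both integrals are O(1/T), hence O(T^(-delta)).  Shimizu's lemma shows that a bottom
   row (c, d) of sigma_j^-1 gamma with c <> 0 has |c| >= 1, and that the determinant of
   the bottom rows of two distinct cosets has absolute value at least 1.  Hence at most
   one term of each sum is nonzero at a given point, and the points x at which a term
   with c <> 0 is nonzero lie within (y / T')^(1/2) / |c| of -d / c, where
   T' = T - eta_0 and |c| (y T')^(1/2) <= 1; a term with c = 0 vanishes because
   y < T'.  Stretched by the factor T' / 2 these intervals become disjoint, so their
   union has measure O(1/T) on a bounded range of x. *)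

(** * Entries, determinants and inverses of two-by-two matrices; action on the boundary *)

Lemma sum_ord2 (V : nmodType) (u : 'I_2 -> V) : \sum_i u i = u 0 + u 1.
Proof.
rewrite big_ord_recl big_ord1; congr (_ + u _); exact/val_inj.
Qed.

Lemma mulmx2E (R : realType) (A B : 'M[R]_2) i k :
  (A *m B) i k = A i 0 * B 0 k + A i 1 * B 1 k.
Proof. by rewrite mxE sum_ord2. Qed.

Lemma ord2P (P : 'I_2 -> Prop) : P 0 -> P 1 -> forall i, P i.
Proof.
move=> P0 P1 [[|[|//]] hi].
- by rewrite (_ : Ordinal hi = 0) //; exact/val_inj.
- by rewrite (_ : Ordinal hi = 1) //; exact/val_inj.
Qed.

Lemma mx2_ext (R : realType) (A B : 'M[R]_2) :
  ma A = ma B -> mb A = mb B -> mc A = mc B -> md A = md B -> A = B.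
Proof.
by move=> ? ? ? ?; apply/matrixP; do 2! apply: ord2P.
Qed.

Lemma mk2E (R : realType) (a b c d : R) :
  [/\ ma (mk2 a b c d) = a, mb (mk2 a b c d) = b,
      mc (mk2 a b c d) = c & md (mk2 a b c d) = d].
Proof. by split; rewrite /ma /mb /mc /md mxE. Qed.

Lemma det_mx2 (R : realType) (A : 'M[R]_2) :
  \det A = ma A * md A - mb A * mc A.
Proof.
have e01 : lift (0 : 'I_2) 0 = 1 by exact/val_inj.
have e10 : lift (1 : 'I_2) 0 = 0 by exact/val_inj.
rewrite (expand_det_row _ 0) sum_ord2 /cofactor !det_mx11 !mxE e01 e10.
by rewrite /ma /mb /mc /md expr0 expr1 mul1r mulN1r mulrN.
Qed.

Lemma mulmx_ma (R : realType) (A B : 'M[R]_2) :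
  ma (A *m B) = ma A * ma B + mb A * mc B.
Proof. exact: mulmx2E. Qed.

Lemma mulmx_mb (R : realType) (A B : 'M[R]_2) :
  mb (A *m B) = ma A * mb B + mb A * md B.
Proof. exact: mulmx2E. Qed.

Lemma mulmx_mc (R : realType) (A B : 'M[R]_2) :
  mc (A *m B) = mc A * ma B + md A * mc B.
Proof. exact: mulmx2E. Qed.

Lemma mulmx_md (R : realType) (A B : 'M[R]_2) :
  md (A *m B) = mc A * mb B + md A * md B.
Proof. exact: mulmx2E. Qed.

Definition mulmx2 := (mulmx_ma, mulmx_mb, mulmx_mc, mulmx_md).

Lemma scalar_mx2 (R : realType) :
  [/\ ma (1%:M : 'M[R]_2) = 1, mb (1%:M : 'M[R]_2) = 0,
      mc (1%:M : 'M[R]_2) = 0 & md (1%:M : 'M[R]_2) = 1].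
Proof. by split; rewrite /ma /mb /mc /md !mxE. Qed.

Lemma unitmx_det1 (R : realType) (A : 'M[R]_2) : \det A = 1 -> A \in unitmx.
Proof. by move=> dA; rewrite unitmxE dA unitr1. Qed.

Lemma invmx2 (R : realType) (A : 'M[R]_2) : \det A = 1 ->
  invmx A = mk2 (md A) (- mb A) (- mc A) (ma A).
Proof.
move=> dA; have uA := unitmx_det1 _ _ dA.
suff e : A *m mk2 (md A) (- mb A) (- mc A) (ma A) = 1%:M.
  by rewrite -[RHS](mulKmx uA) e mulmx1.
move: dA; rewrite det_mx2 => dA.
have [a1 b1 c1 d1] := scalar_mx2 R.
have [a2 b2 c2 d2] := mk2E R (md A) (- mb A) (- mc A) (ma A).
by apply: mx2_ext; rewrite !mulmx2 ?a2 ?b2 ?c2 ?d2 ?a1 ?b1 ?c1 ?d1;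
  rewrite -?dA; ring.
Qed.

Lemma invmx_ma (R : realType) (A : 'M[R]_2) : \det A = 1 -> ma (invmx A) = md A.
Proof. by move=> /invmx2 ->; rewrite /ma mxE. Qed.

Lemma invmx_mb (R : realType) (A : 'M[R]_2) : \det A = 1 -> mb (invmx A) = - mb A.
Proof. by move=> /invmx2 ->; rewrite /mb mxE. Qed.

Lemma invmx_mc (R : realType) (A : 'M[R]_2) : \det A = 1 -> mc (invmx A) = - mc A.
Proof. by move=> /invmx2 ->; rewrite /mc mxE. Qed.

Lemma invmx_md (R : realType) (A : 'M[R]_2) : \det A = 1 -> md (invmx A) = ma A.
Proof. by move=> /invmx2 ->; rewrite /md mxE. Qed.

Lemma det_invmx1 (R : realType) (A : 'M[R]_2) : \det A = 1 -> \det (invmx A) = 1.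
Proof. by move=> dA; rewrite det_inv dA invr1. Qed.

Lemma act_bd_comp (R : realType) (A B : 'M[R]_2) k :
  \det A = 1 -> \det B = 1 -> act_bd A (act_bd B k) = act_bd (A *m B) k.
Proof.
rewrite !det_mx2 => dA dB; case: k => [x|] /=.
- case: eqP => [e|/eqP e] /=; rewrite !mulmx2.
  (* At the pole [x] of [B] the numerator cannot vanish as well, because [\det B = 1]; the composite
     fraction then reduces to the image of infinity under [A]. *)
  + have e' : ma B * x + mb B != 0.
      apply/eqP => f.
      have : ma B * md B - mb B * mc B = 0; last by rewrite dB; apply/eqP/oner_neq0.
      have [B0|B0] := eqVneq (ma B) 0.
        by move: f; rewrite B0 mul0r add0r => ->; ring.
      have xE : x = - mb B / ma B by apply: (mulfI B0); rewrite mulrCA divff // mulr1; lra.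
      by move: e; rewrite xE => e; rewrite -[RHS](mulr0 (ma B)) -e; field.
    have -> : (mc A * ma B + md A * mc B) * x + (mc A * mb B + md A * md B) =
      mc A * (ma B * x + mb B) + md A * (mc B * x + md B) by ring.
    have -> : (ma A * ma B + mb A * mc B) * x + (ma A * mb B + mb A * md B) =
      ma A * (ma B * x + mb B) + mb A * (mc B * x + md B) by ring.
    rewrite e !mulr0 !addr0 mulf_eq0 (negPf e') orbF.
    by case: eqP => // /eqP ?; congr Some; field; apply/andP.
  + have -> : (mc A * ma B + md A * mc B) * x + (mc A * mb B + md A * md B) =
      (mc A * ((ma B * x + mb B) / (mc B * x + md B)) + md A) * (mc B * x + md B)
      by field.
    rewrite mulf_eq0 (negPf e) orbF; case: eqP => // /eqP ne; congr Some.
    have -> : (ma A * ma B + mb A * mc B) * x + (ma A * mb B + mb A * md B) =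
      (ma A * ((ma B * x + mb B) / (mc B * x + md B)) + mb A) * (mc B * x + md B)
      by field.
    by rewrite -mulf_div divff // mulr1.
- case: eqP => [e|/eqP e] /=; rewrite !mulmx2.
  + have B0 : ma B != 0.
      by apply/eqP => f; move/eqP: dB; rewrite e f mul0r mulr0 subr0 eq_sym oner_eq0.
    rewrite e !mulr0 !addr0 mulf_eq0 (negPf B0) orbF.
    by case: eqP => // /eqP ?; congr Some; field; apply/andP.
  + have -> : mc A * ma B + md A * mc B = (mc A * (ma B / mc B) + md A) * mc B by field.
    rewrite mulf_eq0 (negPf e) orbF; case: eqP => // /eqP ne; congr Some.
    have -> : ma A * ma B + mb A * mc B = (ma A * (ma B / mc B) + mb A) * mc B by field.
    by rewrite -mulf_div divff // mulr1.
Qed.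

(** * Shimizu's lemma and discreteness of conjugate groups *)

Lemma exists_expr_lt (R : realType) (x e : R) : 0 <= x < 1 -> 0 < e ->
  exists n, x ^+ n < e.
Proof.
move=> /andP[x0 x1] e0.
have /cvgrPdist_lt/(_ _ e0) : (x ^+ n @[n --> \oo] --> (0 : R))%classic.
  by apply: cvg_expr; rewrite ger0_norm.
by case=> n _ /(_ n (leqnn n)) /=; rewrite sub0r normrN ger0_norm ?exprn_ge0 //; exists n.
Qed.

(** A conjugate of the unipotent generator depends only on the first column (a, c) of [A]: it is the
    identity plus the product of that column with the row (-c, a). The entry -c^2 drives the
    iteration in Shimizu's lemma and later bounds single bottom rows. *)
Lemma conj_unipotent (R : realType) (A : 'M[R]_2) : \det A = 1 ->
  let B := A *m mk2 1 1 0 1 *m invmx A in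
  [/\ ma B = 1 - ma A * mc A, mb B = ma A ^+ 2,
      mc B = - mc A ^+ 2 & md B = 1 + ma A * mc A].
Proof.
move=> dA; have [u1 u2 u3 u4] := mk2E R 1 1 0 1.
rewrite /= !mulmx2 u1 u2 u3 u4 invmx_ma // invmx_mb // invmx_mc // invmx_md //.
rewrite !mulr1 !mulr0 !addr0.
by move: dA; rewrite det_mx2 => dA; split; rewrite -?dA; ring.
Qed.

(* Shimizu's lemma: if [0 < |c| < 1], the iterates of [A |-> A U A^-1] converge
   to [U] without ever reaching it. *)
Lemma shimizu (R : realType) (H : set 'M[R]_2) (e : R) :
  (forall A, H A -> \det A = 1) ->
  (forall A B, H A -> H B -> H (A *m B)) ->
  (forall A, H A -> H (invmx A)) ->
  H (mk2 1 1 0 1) -> 0 < e ->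
  (forall A, H A -> `|ma A - 1| < e -> `|mb A| < e -> `|mc A| < e ->
    `|md A - 1| < e -> A = 1%:M) ->
  forall A, H A -> mc A != 0 -> 1 <= `|mc A|.
Proof.
move=> Hdet HM HV HU e0 Hdisc A HA cA; rewrite leNgt; apply/negP => c1.
pose st B : 'M[R]_2 := B *m mk2 1 1 0 1 *m invmx B.
(* [K] bounds the upper left entries of all iterates: one step gives |a'| <= 1 + |a||c|, and [K] is
   at least 1 + [K]|c|. *)
pose K := `|ma A| + (1 - `|mc A|)^-1.
have c1' : 0 < 1 - `|mc A| by lra.
have i1 : 0 < (1 - `|mc A|)^-1 by rewrite invr_gt0.
have K0 : 0 < K by rewrite /K; have := normr_ge0 (ma A); lra.
have KE : 1 + K * `|mc A| <= K.
  have : 1 <= K * (1 - `|mc A|); last by lra.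
  rewrite /K mulrDl mulVf ?gt_eqF // lerDr mulr_ge0 // ltW //.
have inv n : let B := iter n st A in
    [/\ H B, `|ma B| <= K, mc B != 0 & `|mc B| <= `|mc A| ^+ n.+1].
  elim: n => [|n] /=.
    by split => //; rewrite ?expr1 // /K; lra.
  set B := iter n st A => -[HB aB c0 cB].
  have [e1 e2 e3 e4] := conj_unipotent R B (Hdet _ HB).
  have cBA : `|mc B| <= `|mc A|.
    by apply: (le_trans cB); rewrite exprS ler_piMr // exprn_ile1 // ltW.
  split.
  - by apply: (HM _ _ (HM _ _ HB HU)); exact: HV.
  - rewrite e1; apply: (le_trans (ler_normB _ _)); rewrite normr1 normrM.
    apply: (le_trans _ KE); rewrite lerD2l ler_pM //.
  - by rewrite e3 oppr_eq0 expf_neq0.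
  - rewrite e3 normrN normrX expr2 exprS; apply: ler_pM => //.
(* Since [eps] <= 1/2, squares of quantities bounded by [eps] are at most [eps]/2; the entries of
   [V] below then deviate from the identity by at most 3[eps] <= [e]/2. *)
pose eps := Num.min (e / 6) (1 / 2).
have eps0 : 0 < eps by rewrite lt_min; apply/andP; split; lra.
have [eps1 eps2] : eps <= e / 6 /\ eps <= 1 / 2.
  by split; rewrite ge_min lexx ?orbT.
(* This [n] makes ([K] + 1)|c| <= [eps] for the iterate [B], so that both c and the product ac are
   small. *)
have [n hn] : exists n, `|mc A| ^+ n < eps / (K + 1).
  by apply: exists_expr_lt; [rewrite normr_ge0 | apply: divr_gt0 => //; lra].
have [HB aB c0 cB] := inv n; set B := iter n st A in HB aB c0 cB.
have [HB1 _ c01 _] := inv n.+1.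
have [HB2 _ c02 _] := inv n.+2.
move: HB1 c01 HB2 c02; rewrite !iterS -/B => HB1 c01 HB2 c02.
have [e1 e2 e3 e4] := conj_unipotent R B (Hdet _ HB).
have [f1 f2 f3 f4] := conj_unipotent R (st B) (Hdet _ HB1).
have cBe : (K + 1) * `|mc B| <= eps.
  have : `|mc B| <= eps / (K + 1).
    apply: (le_trans cB); apply: (le_trans _ (ltW hn)).
    by rewrite exprS ler_piMl // ?exprn_ge0 // ltW.
  by rewrite ler_pdivlMr ?(mulrC (K + 1)) //; lra.
set x := ma B * mc B; set y := mc B in cBe *.
have xe : `|x| <= eps.
  apply: (le_trans _ cBe); rewrite normrM; apply: ler_pM => //; lra.
have ye : `|y| <= eps.
  apply: (le_trans _ cBe); rewrite ler_peMl //; lra.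
move: e1 e3; rewrite -/x -/y -/(st B) => e1 e3.
(* Two steps after [B] all entries are polynomials in [x] = ac and [y] = c. Dividing by the
   unipotent generator turns closeness to that generator into closeness to the identity, where
   discreteness applies. *)
pose V := st (st B) *m invmx (mk2 1 1 0 1).
have HV' : H V by apply: HM => //; exact: HV.
have [u1 u2 u3 u4] := mk2E R 1 1 0 1.
have dU : \det (mk2 1 1 0 1 : 'M[R]_2) = 1 by exact: Hdet.
have VE : [/\ ma V - 1 = (1 - x) * y ^+ 2,
     mb V = - x * 2 + x ^+ 2 - (1 - x) * y ^+ 2, mc V = - y ^+ 4 &
     md V - 1 = - ((1 - x) * y ^+ 2) + y ^+ 4].
  move: f1 f2 f3 f4; rewrite /V -/(st (st B)) e1 e3.
  move: (st (st B)) => W f1 f2 f3 f4.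
  rewrite !mulmx2 (invmx_ma _ _ dU) (invmx_mb _ _ dU) (invmx_mc _ _ dU).
  by rewrite (invmx_md _ _ dU) u1 u2 u3 u4 f1 f2 f3 f4; split; ring.
have V1 : V = 1%:M.
  have [g1 g2 g3 g4] := VE.
  move: xe ye; rewrite !ler_norml => /andP[x1 x2] /andP[y1 y2].
  have yy : 0 <= y ^+ 2 <= eps / 2 by apply/andP; split; nra.
  have xx : 0 <= x ^+ 2 <= eps / 2 by apply/andP; split; nra.
  have y4 : 0 <= y ^+ 4 <= eps / 2.
    rewrite (_ : y ^+ 4 = y ^+ 2 * y ^+ 2); last by ring.
    by move: yy; set w := y ^+ 2 => /andP[? ?]; apply/andP; split; nra.
  have xy : 0 <= (1 - x) * y ^+ 2 <= eps.
    by move: yy; set w := y ^+ 2 => /andP[? ?]; apply/andP; split; nra.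
  move: g1 g2 g3 g4 yy xx y4 xy.
  move: (y ^+ 4) => p; move: ((1 - x) * _) => q; move: (x ^+ 2) => r.
  move=> g1 g2 g3 g4 _ /andP[r1 r2] /andP[p1 p2] /andP[q1 q2].
  by apply: Hdisc => //; rewrite ?g1 ?g2 ?g3 ?g4 ltr_norml; apply/andP; split;
    move: r1 r2 p1 p2 q1 q2 x1 x2 eps0 eps1; clear; lra.
(* The generator has lower left entry 0, whereas no iterate does. *)
have : st (st B) = mk2 1 1 0 1.
  rewrite -[LHS](mulmxKV (unitmx_det1 R _ dU)) -/V V1 mul1mx //.
by move=> s; move/eqP: c02; rewrite s u3.
Qed.

Lemma entry_norm_le (R : realType) (A : 'M[R]_2) i k :
  `|A i k| <= `|ma A| + `|mb A| + `|mc A| + `|md A|.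
Proof.
have a := normr_ge0 (ma A); have b := normr_ge0 (mb A).
have c := normr_ge0 (mc A); have d := normr_ge0 (md A).
move: a b c d; rewrite /ma /mb /mc /md => a b c d.
by move: i k; do 2! apply: ord2P; lra.
Qed.

Definition conj_group {R : realType} (G : set 'M[R]_2) (s : 'M[R]_2) :
  set 'M[R]_2 := [set invmx s *m A *m s | A in G].

(** Conjugating back by [s] is linear, so it enlarges the distance to the identity by a factor
    controlled by the entries of [s], and a smaller radius serves for the conjugate group. *)
Lemma conj_group_discrete (R : realType) (G : set 'M[R]_2) (s : 'M[R]_2) :
  fuchsian G -> \det s = 1 -> exists2 e : R, 0 < e &
  forall M, conj_group G s M -> `|ma M - 1| < e -> `|mb M| < e ->
    `|mc M| < e -> `|md M - 1| < e -> M = 1%:M.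
Proof.
move=> [_ _ _ _ [e [e0 disc]]] ds.
pose k := `|ma s| + `|mb s| + `|mc s| + `|md s| + 1.
have us := unitmx_det1 _ _ ds.
have k1 : 1 <= k.
  rewrite /k; have := normr_ge0 (ma s); have := normr_ge0 (mb s).
  by have := normr_ge0 (mc s); have := normr_ge0 (md s); lra.
have sk i l : `|s i l| <= k.
  by apply: (le_trans (entry_norm_le _ _ _ _)); rewrite /k; lra.
have ik i l : `|invmx s i l| <= k.
  apply: (le_trans (entry_norm_le _ _ _ _)).
  by rewrite invmx_ma // invmx_mb // invmx_mc // invmx_md // !normrN /k; lra.
have k0 : 0 < k by lra.
have kk0 : 0 < 8 * (k * k) by rewrite !mulr_gt0.
(* Each entry of the conjugated difference is a sum of four products, each at most [e]/8, which
   leaves the total at [e]/2. *)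
exists (e / (8 * (k * k))); first exact: divr_gt0.
move=> _ [A GA <-]; set M := invmx s *m A *m s => m1 m2 m3 m4.
pose t := e / (8 * (k * k)); pose E := M - 1%:M.
have tE : 8 * (k * k) * t = e by rewrite /t mulrC divfK // gt_eqF.
have Et i l : `|E i l| < t.
  move: m1 m2 m3 m4; rewrite -/t /ma /mb /mc /md => m1 m2 m3 m4.
  move: m1 m2 m3 m4; rewrite /E {E}; move: M => W m1 m2 m3 m4.
  by move: i l; do 2! apply: ord2P; rewrite !mxE /= ?mulr1n ?mulr0n ?subr0.
have AE : A - 1%:M = s *m E *m invmx s.
  rewrite /E /M mulmxBr mulmxBl mulmx1 mulmxV // !mulmxA mulmxV // mul1mx.
  by rewrite -mulmxA mulmxV // mulmx1.
suff A1 : A = 1 by rewrite /M A1 mulmx1 mulVmx.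
apply: disc => // i l.
have -> : A i l - (1 : 'M[R]_2) i l = (A - 1%:M) i l by rewrite [RHS]mxE [X in _ = _ + X]mxE.
have bd u v w : `|u| <= k -> `|v| < t -> `|w| <= k -> `|u * v * w| <= k * t * k.
  by move=> ? ? ?; rewrite !normrM; apply: ler_pM; rewrite ?mulr_ge0 // ler_pM // ltW.
rewrite AE !mulmx2E !mulrDl.
have b00 := bd _ _ _ (sk i 0) (Et 0 0) (ik 0 l).
have b10 := bd _ _ _ (sk i 1) (Et 1 0) (ik 0 l).
have b01 := bd _ _ _ (sk i 0) (Et 0 1) (ik 1 l).
have b11 := bd _ _ _ (sk i 1) (Et 1 1) (ik 1 l).
have ktk : k * t * k = e / 8 by rewrite -tE; field.
apply: (le_lt_trans (ler_normD _ _)).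
apply: (@le_lt_trans _ _ (k * t * k + k * t * k + (k * t * k + k * t * k))).
  by apply: lerD; apply: (le_trans (ler_normD _ _)); apply: lerD.
by rewrite ktk; clear -e0; lra.
Qed.

Lemma conj_group_mc (R : realType) (G : set 'M[R]_2) (s M : 'M[R]_2) :
  fuchsian G -> \det s = 1 -> conj_group G s (mk2 1 1 0 1) ->
  conj_group G s M -> mc M != 0 -> 1 <= `|mc M|.
Proof.
move=> fG ds HU HM cM; have [e e0 disc] := conj_group_discrete R G s fG ds.
have [Gdet _ GM GV _] := fG; have us := unitmx_det1 _ _ ds.
apply: (shimizu R (conj_group G s) e) => //.
- move=> _ [A GA <-]; rewrite !det_mulmx (Gdet _ GA) det_inv ds invr1 !mulr1 //.
- move=> _ _ [A GA <-] [B GB <-]; exists (A *m B); first exact: GM.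
  by rewrite !mulmxA (mulmxK us).
- move=> _ [A GA <-]; exists (invmx A); first exact: GV.
  have uA := unitmx_det1 _ _ (Gdet _ GA).
  have uX : invmx s *m A *m s \in unitmx by rewrite !unitmx_mul unitmx_inv us uA.
  rewrite -[RHS]mul1mx; apply: (canRL (mulmxK uX)).
  by rewrite !mulmxA (mulmxK us) (mulmxKV uA) mulVmx.
Qed.

(** A vanishing lower left entry means that the conjugate fixes infinity, so [A] fixes the image of
    infinity under [s], the cusp [kappa j]. This is how a zero determinant of two bottom rows will
    force equal cosets. *)
Lemma stab_of_conj (R : realType) (G : set 'M[R]_2) (kappa : nat -> option R) j
    (s A : 'M[R]_2) :
  fuchsian G -> \det s = 1 -> act_bd s None = kappa j -> G A ->
  mc (invmx s *m A *m s) = 0 -> stab G kappa j A.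
Proof.
move=> [Gdet _ _ _ _] ds ks GA cM; split => //.
have us := unitmx_det1 _ _ ds.
have dM : \det (invmx s *m A *m s) = 1.
  by rewrite !det_mulmx (Gdet _ GA) det_inv ds invr1 !mulr1.
rewrite -ks (act_bd_comp R A s None (Gdet _ GA) ds).
rewrite (_ : A *m s = s *m (invmx s *m A *m s)); last first.
  by rewrite !mulmxA mulmxV // mul1mx.
by rewrite -act_bd_comp // {2}/act_bd cM eqxx.
Qed.

(** * Moebius action on the upper half plane *)

(** The sum is the squared modulus of cz + d; its vanishing would force c = d = 0. *)
Lemma mob_den_gt0 (R : realType) (A : 'M[R]_2) (x y : R) :
  \det A = 1 -> 0 < y -> 0 < (mc A * x + md A) ^+ 2 + (mc A * y) ^+ 2.
Proof.
rewrite det_mx2 => dA y0; rewrite lt_neqAle addr_ge0 ?sqr_ge0 // andbT eq_sym.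
rewrite paddr_eq0 ?sqr_ge0 // !expf_eq0 /= mulf_eq0 (gt_eqF y0) orbF.
apply/negP => /andP[/eqP d0 /eqP c0]; move/eqP: dA.
by move: d0; rewrite c0 mul0r add0r => ->; rewrite !mulr0 subr0 eq_sym oner_eq0.
Qed.

Lemma Im_mob (R : realType) (A : 'M[R]_2) (x y : R) : \det A = 1 -> 0 < y ->
  complex.Im (mob A (x +i* y)) = y / ((mc A * x + md A) ^+ 2 + (mc A * y) ^+ 2).
Proof.
move=> dA y0; have /gt_eqF/negbT n0 := mob_den_gt0 R A x y dA y0.
move: dA; rewrite det_mx2 => dA.
rewrite /mob /= !mul0r !subr0 !addr0.
transitivity ((ma A * md A - mb A * mc A) * y /
  ((mc A * x + md A) ^+ 2 + (mc A * y) ^+ 2)); last by rewrite dA mul1r.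
by field.
Qed.

Lemma mob_comp (R : realType) (A B : 'M[R]_2) (x y : R) :
  \det B = 1 -> 0 < y ->
  mob A (mob B (x +i* y)) = mob (A *m B) (x +i* y).
Proof.
move=> dB y0; rewrite /mob; set z := x +i* y; set f := (mc B)%:C * z + (md B)%:C.
have f0 : f != 0.
  apply/eqP => /eqP; rewrite eq_complex /= !mul0r subr0 !addr0 => /andP[/eqP e1 /eqP e2].
  have := mob_den_gt0 R B x y dB y0.
  by rewrite e1 e2 expr0n /= addr0 ltxx.
rewrite !mulmx2 !rmorphD !rmorphM /=.
rewrite -[LHS]mulr1 -(divff f0) mulf_div; congr (_ / _); rewrite mulrDl mulrA divfK //.
- by rewrite /f; ring.
- by rewrite /f; ring.
Qed.

(** * Measure of a union of Farey-type intervals, and integrals bounded through a support *)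

(** Counting how many steps of length [gap] fit between [lo] and [p s] gives an injection into a
    finite initial segment of the naturals. *)
Lemma finite_separated (R : realType) (I : choiceType) (D : set I) (p : I -> R)
    (lo hi gap : R) : 0 < gap ->
  (forall s, D s -> lo <= p s <= hi) ->
  (forall s s', D s -> D s' -> s != s' -> gap <= `|p s - p s'|) ->
  finite_set D.
Proof.
move=> gap0 bd sep.
pose n s := Num.truncn ((p s - lo) / gap).
have nP s : D s -> ((n s)%:R <= (p s - lo) / gap < (n s).+1%:R).
  move=> /bd /andP[lop _]; apply: truncn_itv.
  by rewrite divr_ge0 ?subr_ge0 // ltW.
have injn : {in D &, injective n}.
  move=> s s'; rewrite !inE => Ds Ds' e; apply/eqP/negP => /negP ne.
  have := sep _ _ Ds Ds' ne; apply/negP; rewrite -ltNge.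
  have /andP[a1 a2] := nP _ Ds; have /andP[b1 b2] := nP _ Ds'; rewrite -e in b1 b2.
  rewrite -[X in _ < X]mul1r -ltr_pdivrMr // -(gtr0_norm gap0) -normf_div.
  have -> : (p s - p s') / gap = (p s - lo) / gap - (p s' - lo) / gap.
    by rewrite -mulrBl; congr (_ / _); ring.
  rewrite -[(n s).+1]addn1 natrD in a2 b2.
  by rewrite ltr_norml; apply/andP; split; move: a1 a2 b1 b2; clear; lra.
rewrite -(eq_finite_set (inj_card_eq injn)).
apply: (@sub_finite_set _ _ `I_(Num.truncn ((hi - lo) / gap)).+1) => //.
move=> _ [s Ds <-] /=; rewrite ltnS; apply: le_truncn.
by have /andP[_ ?] := bd _ Ds; rewrite ler_pM2r ?invr_gt0 // lerD2r.
Qed.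

(** The points [p s] = -d/c behave like Farey fractions: two of them are at least 1/|cc'| apart. The
    intervals [I_] cover the points in question, and [J_] is [I_] stretched by [t]/2 about its
    centre. The [J_] are disjoint and lie in a bounded window, so the [I_] have total length at most
    2/[t] times that of the window. *)
Lemma farey_measure (R : realType) (I : choiceType) (S : set I) (c d : I -> R)
    (y t al be : R) :
  (forall s s', S s -> S s' -> s != s' -> 1 <= `|c s * d s' - c s' * d s|) ->
  (forall s, S s -> c s != 0 -> 1 <= `|c s|) ->
  0 < y -> 1 < t -> al <= be ->
  exists A : set R, [/\ measurable A,
    (lebesgue_measure A <= (2 / t * (be - al + 4))%:E)%E &
    forall x s, al <= x <= be -> S s -> c s != 0 ->
      t <= y / ((c s * x + d s) ^+ 2 + (c s * y) ^+ 2) -> A x].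
Proof.
move=> sep c1 y0 t1 albe.
have t0 : 0 < t by lra.
pose q := Num.sqrt (y * t).
have q0 : 0 < q by rewrite sqrtr_gt0 mulr_gt0.
have qq : q ^+ 2 = y * t by rewrite sqr_sqrtr // ltW // mulr_gt0.
pose p s := - d s / c s.
(* The condition |c|[q] <= 1 restates [t](cy)^2 <= y. The window is widened by 1 because a centre
   lies within 1 of every point its interval has to cover. *)
pose D := [set s | [/\ S s, c s != 0, `|c s| * q <= 1 & al - 1 <= p s <= be + 1]].
have psep s s' : D s -> D s' -> s != s' -> 1 <= `|p s - p s'| * (`|c s| * `|c s'|).
  move=> [Ss cs _ _] [Ss' cs' _ _] ne; have := sep _ _ Ss Ss' ne.
  rewrite -!normrM; congr (_ <= `|_|); rewrite /p; field.
  by rewrite cs cs'.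
have finD : finite_set D.
  apply: (@finite_separated R I D p (al - 1) (be + 1) (q ^+ 2)).
  - by rewrite exprn_gt0.
  - by move=> s [].
  - move=> s s' Ds Ds' ne; have := psep _ _ Ds Ds' ne.
    have [_ cs h _] := Ds; have [_ cs' h' _] := Ds' => h1.
    rewrite -[X in X <= _]mul1r; apply: (@le_trans _ _ (`|p s - p s'| * (`|c s| * `|c s'|) * q ^+ 2)).
      by rewrite ler_pM2r // exprn_gt0.
    rewrite -mulrA ler_piMr //.
    rewrite (_ : _ * _ = (`|c s| * q) * (`|c s'| * q)); last by ring.
    by rewrite mulr_ile1 // mulr_ge0 // ltW.
pose I_ s : set R := `[p s - q / (t * `|c s|), p s + q / (t * `|c s|)]%classic.
pose J_ s : set R := `]p s - q / (2 * `|c s|), p s + q / (2 * `|c s|)[%classic.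
have cq s : D s -> 0 < q / `|c s|.
  by move=> [_ cs _ _]; rewrite divr_gt0 // normr_gt0.
have muI s : D s -> lebesgue_measure (I_ s) = ((2 / t) * (q / `|c s|))%:E.
  move=> Ds; have := cq _ Ds; have [_ cs _ _] := Ds => cq0.
  rewrite /I_ lebesgue_measure_itv /= lte_fin.
  have -> : q / (t * `|c s|) = (q / `|c s|) / t.
    by rewrite invfM mulrA mulrAC.
  have h : 0 < q / `|c s| / t by rewrite divr_gt0.
  rewrite ifT; last by move: h; clear; lra.
  by rewrite -EFinB; congr EFin; field; rewrite ?normr_eq0 ?cs ?(gt_eqF t0).
have muJ s : D s -> lebesgue_measure (J_ s) = (q / `|c s|)%:E.
  move=> Ds; have := cq _ Ds; have [_ cs _ _] := Ds => cq0.
  rewrite /J_ lebesgue_measure_itv /= lte_fin.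
  have -> : q / (2 * `|c s|) = (q / `|c s|) / 2.
    by rewrite invfM mulrA mulrAC.
  rewrite ifT; last by move: cq0; clear; lra.
  by rewrite -EFinB; congr EFin; field; rewrite ?normr_eq0 ?cs.
(* A common point would make |p - p'||cc'| smaller than (|c|[q] + |c'|[q])/2 <= 1, against
   [psep]. *)
have trivJ : trivIset D J_.
  move=> s s' Ds Ds' [x []]; rewrite /J_ /= !in_itv /= => /andP[a1 a2] /andP[b1 b2].
  apply/eqP/negP => /negP ne.
  have := psep _ _ Ds Ds' ne; apply/negP; rewrite -ltNge.
  have [_ cs h _] := Ds; have [_ cs' h' _] := Ds'.
  have C0 : 0 < `|c s| by rewrite normr_gt0.
  have C0' : 0 < `|c s'| by rewrite normr_gt0.
  have : `|p s - p s'| < q / (2 * `|c s|) + q / (2 * `|c s'|).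
    by rewrite ltr_norml; apply/andP; split; move: a1 a2 b1 b2; clear; lra.
  have CC : 0 < `|c s| * `|c s'| by rewrite mulr_gt0.
  rewrite -(ltr_pM2r CC) => /lt_le_trans; apply.
  have -> : (q / (2 * `|c s|) + q / (2 * `|c s'|)) * (`|c s| * `|c s'|) =
    (`|c s| * q + `|c s'| * q) / 2 by field; rewrite !gt_eqF.
  by move: h h'; clear; lra.
exists (\bigcup_(s in D) I_ s).
have mI s : D s -> measurable (I_ s) by move=> _; exact: measurable_itv.
have mJ s : D s -> measurable (J_ s) by move=> _; exact: measurable_itv.
have mUI : measurable (\bigcup_(s in D) I_ s) by exact: fin_bigcup_measurable.
have mUJ : measurable (\bigcup_(s in D) J_ s) by exact: fin_bigcup_measurable.
have t2 : 0 <= 2 / t by rewrite divr_ge0 // ltW.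
split => //.
- have sub : (lebesgue_measure (\bigcup_(s in D) I_ s) <=
      (\sum_(s \in D) lebesgue_measure (I_ s))%R)%E.
    exact: (content_sub_fsum (@lebesgue_measure R) finD mI mUI).
  apply: (le_trans sub).
  have -> : \sum_(s \in D) lebesgue_measure (I_ s) =
      ((2 / t)%:E * (\sum_(s \in D) lebesgue_measure (J_ s))%R)%E.
    rewrite ge0_mule_fsumr; last by move=> s; exact: measure_ge0.
    by apply: eq_fsbigr => s /set_mem Ds; rewrite muI // muJ // EFinM.
  have <- : lebesgue_measure (\bigcup_(s in D) J_ s) =
      \sum_(s \in D) lebesgue_measure (J_ s).
    exact: (measure_fin_bigcup (@lebesgue_measure R) finD trivJ mJ).
  rewrite (EFinM (2 / t)); apply: lee_wpmul2l; first by rewrite lee_fin.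
  (* Centres lie within 1 of [[al], [be]] and half-widths are at most 1, whence the margin 2 on
     either side. *)
  have -> : (be - al + 4)%:E = lebesgue_measure (`[al - 2, be + 2]%classic : set R).
    rewrite lebesgue_measure_itv /= lte_fin ifT; last by lra.
    by rewrite -EFinB; congr EFin; ring.
  apply: le_measure; rewrite ?inE //.
  move=> x [s Ds]; rewrite /J_ /= !in_itv /= => /andP[a1 a2].
  have [Ss cs h /andP[b1 b2]] := Ds; have C1 := c1 _ Ss cs.
  have hq : q / (2 * `|c s|) <= 1.
    rewrite ler_pdivrMr; last by move: C1; clear; lra.
    by rewrite mul1r; move: h C1 q0; clear; nra.
  by apply/andP; split; move: a1 a2 b1 b2 hq; clear; lra.
- move=> x s /andP[x1 x2] Ss cs; have C1 := c1 _ Ss cs.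
  (* Dropping [u] from the denominator bounds |c|; dropping [v] bounds the distance from [x] to
     -d/c. *)
  set u := (c s * x + d s) ^+ 2; set v := (c s * y) ^+ 2.
  have u0 : 0 <= u by rewrite sqr_ge0.
  have v0 : 0 < v by rewrite exprn_even_gt0 //= mulf_neq0 // gt_eqF.
  rewrite ler_pdivlMr; last by move: u0 v0; clear; lra.
  move=> h.
  have hv : t * v <= y.
    apply: le_trans h; rewrite ler_pM2l //; move: u0; clear; lra.
  have hu : t * u <= y.
    apply: le_trans h; rewrite ler_pM2l //; move: v0; clear; lra.
  have cq1 : `|c s| * q <= 1.
    rewrite -(ler_pXn2r (_ : 0 < 2)%N) ?nnegrE ?mulr_ge0 // ?(ltW q0) //.
    rewrite exprMn qq expr1n real_normK ?num_real //.
    rewrite -(ler_pM2r y0) mul1r; apply: le_trans hv.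
    by rewrite /v le_eqVlt; apply/orP; left; apply/eqP; ring.
  have up : `|x - p s| <= q / (t * `|c s|).
    have C0 : 0 < `|c s| by move: C1; clear; lra.
    rewrite ler_pdivlMr ?mulr_gt0 //.
    rewrite -(ler_pXn2r (_ : 0 < 2)%N) ?nnegrE ?mulr_ge0 ?(ltW t0) ?(ltW q0) //.
    rewrite qq -[t in `|_| * (t * _)](gtr0_norm t0) -!normrM real_normK ?num_real //.
    have -> : ((x - p s) * (t * c s)) ^+ 2 = (t * u) * t.
      by rewrite /u /p; field.
    by rewrite ler_pM2r.
  have r1 : q / (t * `|c s|) <= 1.
    rewrite ler_pdivrMr ?mulr_gt0 ?normr_gt0 // mul1r.
    apply: (@le_trans _ _ 1).
      by move: cq1 C1 q0; clear; nra.
    by move: t1 C1; clear; nra.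
  move: up; rewrite ler_norml => /andP[w1 w2].
  exists s; first split => //.
    by apply/andP; split; move: w1 w2 x1 x2 r1; clear; lra.
  by rewrite /I_ /= in_itv /=; apply/andP; split; move: w1 w2; clear; lra.
Qed.

(* The integral of a nonnegative function is the supremum over the simple functions
   below it, which is monotone in [f] even when [f] is not measurable. *)
Lemma integral_le_measure (R : realType) (D A : set R) (f : R -> \bar R) (M : R) :
  measurable A -> 0 <= M ->
  (forall x, D x -> (0 <= f x <= M%:E)%E) ->
  (forall x, D x -> f x <> 0%E -> A x) ->
  (\int[lebesgue_measure]_(x in D) f x <= M%:E * lebesgue_measure A)%E.
Proof.
move=> mA M0 fM fA; rewrite -integral_cst //.
rewrite !ge0_integralE //; last by move=> x /fM /andP[].
apply: le_ereal_sup => _ [g gf <-]; exists g => // x.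
apply: (le_trans (gf x)); rewrite /patch; case: ifPn => [|_].
  rewrite inE => Dx; case: ifPn => [_|]; first by have /andP[] := fM _ Dx.
  rewrite notin_setE => nA; have [->//|fx] := pselect (f x = 0%E).
  by case: nA; exact: fA.
by case: ifPn.
Qed.

(** The positive and negative parts both have integrals between 0 and [M * K], so their difference
    stays within [M * K] in absolute value. *)
Lemma Rintegral_bound (R : realType) (D A : set R) (f : R -> R) (M K : R) :
  measurable A -> (lebesgue_measure A <= K%:E)%E -> 0 <= M ->
  (forall x, D x -> `|f x| <= M) ->
  (forall x, D x -> f x != 0 -> A x) ->
  `|Rintegral lebesgue_measure D f| <= M * K.
Proof.
move=> mA AK M0 fM fA.
have MK : (M%:E * lebesgue_measure A <= (M * K)%:E)%E.
  by rewrite EFinM lee_wpmul2l // lee_fin.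
have pos : (0 <= \int[lebesgue_measure]_(x in D) (fun x => (f x)%:E)^\+ x <= (M * K)%:E)%E.
  rewrite integral_ge0 /=; last by move=> x _; exact: funepos_ge0.
  apply: le_trans MK; apply: integral_le_measure => // x Dx.
    rewrite funeposE -EFin_max !lee_fin le_max lexx orbT /=.
    by rewrite ge_max M0 andbT (le_trans (ler_norm _)) ?fM.
  rewrite funeposE -EFin_max => ne; apply: fA => //; apply/eqP => f0; apply: ne.
  by rewrite f0 maxxx.
have neg : (0 <= \int[lebesgue_measure]_(x in D) (fun x => (f x)%:E)^\- x <= (M * K)%:E)%E.
  rewrite integral_ge0 /=; last by move=> x _; exact: funeneg_ge0.
  apply: le_trans MK; apply: integral_le_measure => // x Dx.
    rewrite funenegE -EFinN -EFin_max !lee_fin le_max lexx orbT /=.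
    by rewrite ge_max M0 andbT (le_trans (ler_norm _)) // normrN fM.
  rewrite funenegE -EFinN -EFin_max => ne; apply: fA => //; apply/eqP => f0; apply: ne.
  by rewrite f0 oppr0 maxxx.
have fin (a b : \bar R) : (0 <= a <= (M * K)%:E)%E -> (0 <= b <= (M * K)%:E)%E ->
    `|fine (a - b)| <= M * K.
  case: a => [a| |]; rewrite ?leye_eq ?andbF //.
  case: b => [b| |]; rewrite ?leye_eq ?andbF //=.
  rewrite !lee_fin => /andP[a0 a1] /andP[b0 b1].
  by rewrite ler_norml; apply/andP; split; lra.
by rewrite /Rintegral integralE; exact: fin.
Qed.

(** * Bounds for the cutoff and for periodic functions *)

Lemma rho_bound (R : realType) (x : R) : `|rho x| <= `|(ell R)^-1|.
Proof.
rewrite /rho; case: ifPn => [x1|_]; last by rewrite normr0.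
rewrite normrM ler_piMr // ger0_norm ?expR_ge0 // -[X in _ <= X]expR0 ler_expR oppr_le0 invr_ge0 subr_ge0.
by rewrite -real_normK ?num_real // expr_le1 // ltW.
Qed.

(** The height of the mollifier times the length of its support bounds the convolution uniformly in
    [eta], without evaluating [ell]; the summand 1 accounts for the sharp cutoff. *)
Lemma sind_bound (R : realType) (T eta y : R) :
  `|sind T eta y| <= 1 + 2 * `|(ell R)^-1|.
Proof.
have l0 := normr_ge0 (ell R)^-1.
rewrite /sind; case: eqP => [_|/eqP eta0].
  by rewrite /ind_ge; case: ifP => _; rewrite ?normr1 ?normr0; lra.
set e := `|eta| / 2; have e0 : 0 < e by rewrite divr_gt0 // normr_gt0.
apply: (@le_trans _ _ ((e^-1 * `|(ell R)^-1|) * (2 * e))).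
  apply: (@Rintegral_bound R _ `[- e, e]%classic) => //.
  - rewrite lebesgue_measure_itv /= lte_fin ifT; last by lra.
    by rewrite -EFinB lee_fin; lra.
  - by rewrite mulr_ge0 // invr_ge0 ltW.
  - move=> x _; rewrite normrM -[X in _ <= X]mul1r ler_pM //.
      by rewrite /ind_ge; case: ifP => _; rewrite ?normr1 ?normr0.
    rewrite /rho_eps normrM gtr0_norm ?invr_gt0 // ler_pM2l ?invr_gt0 //.
    exact: rho_bound.
  - move=> x _; rewrite mulf_eq0 negb_or => /andP[_].
    rewrite /rho_eps mulf_eq0 negb_or => /andP[_]; rewrite /rho.
    case: ifPn => [h _|_]; last by rewrite eqxx.
    move: h; rewrite normf_div (gtr0_norm e0) ltr_pdivrMr // mul1r ltr_norml.
    by move=> /andP[h1 h2]; rewrite /= in_itv /=; apply/andP; split; exact: ltW.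
have -> : e^-1 * `|(ell R)^-1| * (2 * e) = 2 * `|(ell R)^-1|.
  by rewrite mulrCA [e^-1 * _]mulrC mulfVK // gt_eqF.
by rewrite lerDr.
Qed.

(** Where the indicator equals 1 one has [s] <= [y - T - eta / 2] < -|[eta]|/2, which is outside the
    support of the mollifier. The threshold [T - |eta|] serves both signs of [eta]. *)
Lemma sind_eq0 (R : realType) (T eta y : R) : y < T - `|eta| -> sind T eta y = 0.
Proof.
move=> yT; rewrite /sind; case: eqP => [e|/eqP eta0].
  by move: yT; rewrite /ind_ge e normr0 subr0 ltNge => /negPf ->.
set e := `|eta| / 2; have e0 : 0 < e by rewrite divr_gt0 // normr_gt0.
rewrite /Rintegral integral0_eq // => x _; congr EFin.
rewrite /ind_ge; case: ifPn => h; last by rewrite mul0r.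
rewrite mul1r /rho_eps /rho ifF ?mulr0 //; apply/negbTE; rewrite -leNgt.
rewrite normf_div (gtr0_norm e0) ler_pdivlMr // mul1r -normrN.
apply: le_trans (ler_norm _).
have := ler_norm (- eta); rewrite normrN.
by move: h yT; rewrite /e; move: `|eta| => n h yT; lra.
Qed.

Lemma periodicz (R : realType) (V : Type) (f : R -> V) (p : R) :
  (forall x, f (x + p) = f x) -> forall x (n : int), f (x + p * n%:~R) = f x.
Proof.
move=> fp x n; have nat_case m z : f (z + p * m%:R) = f z.
  elim: m z => [|m IH] z; first by rewrite mulr0 addr0.
  by rewrite -natr1 mulrDr mulr1 addrA fp IH.
case: n => m; first exact: nat_case.
by rewrite NegzE mulrNz mulrN -[in RHS](subrK (p * m.+1%:R) x) nat_case.
Qed.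

Lemma periodic_reduce (R : realType) (V : Type) (f : R -> V) (p : R) : 0 < p ->
  (forall x, f (x + p) = f x) ->
  forall x, exists2 x', 0 <= x' <= p & f x = f x'.
Proof.
move=> p0 fp x; exists (x + p * (- Num.floor (x / p))%:~R); last first.
  by rewrite periodicz.
have /andP[h1 h2] := floor_itv (x / p).
rewrite mulrNz; set n := (Num.floor (x / p))%:~R in h1 h2 *.
rewrite intrD -/n in h2.
move: h1 h2; rewrite ler_pdivlMr // ltr_pdivrMr //.
by move=> h1 h2; apply/andP; split; lra.
Qed.

(** Periodicity reduces both variables to a compact rectangle. *)
Lemma periodic2_bounded (R : realType) (u : R -> R -> R) (p : R) : 0 < p ->
  continuous (fun z : R * R => u z.1 z.2) ->
  (forall x t, u (x + 1) t = u x t) -> (forall x t, u x (t + p) = u x t) ->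
  exists2 M, 0 <= M & forall x t, `|u x t| <= M.
Proof.
move=> p0 cu u1 u2.
have cK : compact (`[0 : R, 1]%classic `*` `[0 : R, p]%classic).
  by apply: compact_setX; exact: segment_compact.
have cf : {within `[0 : R, 1]%classic `*` `[0 : R, p]%classic,
    continuous (fun z : R * R => u z.1 z.2)} by exact: continuous_subspaceT.
have [M [Mr HM]] := compact_bounded (continuous_compact cf cK).
have M1 : M < `|M| + 1 by have := ler_norm M; lra.
exists (`|M| + 1); first by have := normr_ge0 M; lra.
move=> x t.
have [x' xI ex] := periodic_reduce R R (u^~ t) 1 ltr01 (u1^~ t) x.
have [t' tI et] := periodic_reduce R R (u x') p p0 (u2 x') t.
rewrite /= in ex; rewrite ex et; apply: (HM _ M1).
by exists (x', t') => //; split; rewrite /= in_itv.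
Qed.

Lemma torus_fun_bounded (R : realType) (h : R -> R -> R[i]) :
  smooth_torus_fun h -> exists2 M, 0 <= M &
    forall x t, `|complex.Re (h x t)| <= M /\ `|complex.Im (h x t)| <= M.
Proof.
move=> [h1 h2 [S1 [Su1 H1]] [S2 [Su2 H2]]].
have [c1 _ _ _ _] := H1 _ Su1; have [c2 _ _ _ _] := H2 _ Su2.
have p0 : 0 < 2 * pi :> R by rewrite mulr_gt0 // pi_gt0.
have [M1 M10 HM1] := periodic2_bounded R (fun x t => complex.Re (h x t)) _
  p0 c1 (fun x t => congr1 (@complex.Re R) (h1 x t))
  (fun x t => congr1 (@complex.Re R) (h2 x t)).
have [M2 M20 HM2] := periodic2_bounded R (fun x t => complex.Im (h x t)) _
  p0 c2 (fun x t => congr1 (@complex.Im R) (h1 x t))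
  (fun x t => congr1 (@complex.Im R) (h2 x t)).
exists (M1 + M2); first by lra.
by move=> x t; have := HM1 x t; have := HM2 x t; split; lra.
Qed.

(** * Coset representatives and their bottom rows *)

(** The operator [epsilon] meets its specification once some transversal exists. One is built by
    choosing a point of each coset [P A]; as [P A] depends only on the coset, so does the chosen
    point, which gives uniqueness. *)
Lemma transvP (R : realType) (G H : set 'M[R]_2) :
  (forall A, G A -> A \in unitmx) -> H `<=` G -> H 1%:M ->
  (forall A B, H A -> H B -> H (A *m B)) ->
  (forall A, H A -> H (invmx A)) ->
  Defs.transversal G H (transv G H).
Proof.
move=> uG HG H1 HM HV; apply: ClassicalEpsilon.epsilon_spec.
pose P (A : 'M[R]_2) := [set s | G s /\ exists2 g, H g & A = g *m s].
have Pr A : G A -> P A (xget 0 (P A)).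
  by move=> GA; apply: xgetPex; exists A; split => //; exists 1%:M; rewrite ?mul1mx.
have Peq g A : H g -> P (g *m A) = P A.
  move=> Hg; have ug := uG _ (HG _ Hg); apply/seteqP; split => s [Gs [k Hk e]]; split => //.
  - exists (invmx g *m k); first by apply: HM => //; exact: HV.
    by rewrite -mulmxA -e mulKmx.
  - by exists (g *m k); [exact: HM | rewrite e mulmxA].
exists [set xget 0 (P A) | A in G]; split.
  by move=> _ [A GA <-]; have [] := Pr _ GA.
move=> A GA; exists (xget 0 (P A)); split.
  by split; [exists A | have [] := Pr _ GA].
move=> _ [[B GB <-] [g Hg eA]]; have [_ [k Hk eB]] := Pr _ GB.
suff -> : P A = P B by [].
by rewrite eA Peq // {2}eB Peq.
Qed.

Lemma act_bd1 (R : realType) (k : option R) : act_bd 1%:M k = k.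
Proof.
have [a b c d] := scalar_mx2 R; case: k => [x|] /=; rewrite a ?b c ?d ?eqxx //.
by rewrite mul0r add0r oner_eq0 mul1r addr0 divr1.
Qed.

Lemma transv_stabP (R : realType) (G : set 'M[R]_2) (kappa : nat -> option R) j :
  fuchsian G ->
  Defs.transversal G (stab G kappa j) (transv G (stab G kappa j)).
Proof.
move=> [Gdet [G1 _] GM GV _]; apply: transvP.
- by move=> A /Gdet /unitmx_det1.
- by move=> A [].
- by split => //; rewrite act_bd1.
- move=> A B [GA eA] [GB eB]; split; first exact: GM.
  by rewrite -(act_bd_comp R A B _ (Gdet _ GA) (Gdet _ GB)) eB.
- move=> A [GA eA]; split; first exact: GV.
  have dA := Gdet _ GA.
  rewrite -{1}eA (act_bd_comp R _ _ _ (det_invmx1 _ _ dA) dA).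
  by rewrite mulVmx ?act_bd1 ?unitmx_det1.
Qed.

(** Both s' = (s' s^-1) s and s' = 1 s' decompose the same element, so uniqueness in the transversal
    identifies [s] and [s']. *)
Lemma transv_sep (R : realType) (G : set 'M[R]_2) (kappa : nat -> option R) j s s' :
  fuchsian G -> let S := transv G (stab G kappa j) in
  S s -> S s' -> stab G kappa j (s' *m invmx s) -> s = s'.
Proof.
move=> fG S Ss Ss' st; have [SG tr] := transv_stabP R G kappa j fG.
have [Gdet [G1 _] _ _ _] := fG.
have [r [_ uniq]] := tr _ (SG _ Ss').
transitivity r; [symmetry|]; apply: uniq; last first.
- by split => //; exists 1%:M; rewrite ?mul1mx //; split => //; rewrite act_bd1.
- split => //; exists (s' *m invmx s) => //.
  by rewrite mulmxKV // (unitmx_det1 _ _ (Gdet _ (SG _ Ss))).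
Qed.

Lemma conj_quotient (R : realType) (s g g' : 'M[R]_2) :
  \det s = 1 -> \det g = 1 ->
  invmx s *m (g' *m invmx g) *m s = (invmx s *m g') *m invmx (invmx s *m g).
Proof.
move=> ds dg; have us := unitmx_det1 _ _ ds; have ug := unitmx_det1 _ _ dg.
have uN : invmx s *m g \in unitmx by rewrite unitmx_mul unitmx_inv us ug.
apply: (canRL (mulmxK uN)).
by rewrite !mulmxA (mulmxK us) (mulmxKV ug).
Qed.

Lemma det_scaled (R : realType) (s g : 'M[R]_2) :
  \det s = 1 -> \det g = 1 -> \det (invmx s *m g) = 1.
Proof. by move=> ds dg; rewrite det_mulmx det_inv ds dg invr1 mulr1. Qed.

Lemma Ginf_unipotent (R : realType) : Ginf (mk2 1 1 0 1 : 'M[R]_2).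
Proof. by exists 1; left. Qed.

(** The matrices [N s] lie in a translate of the group, not in the conjugate group itself, so
    Shimizu's bound is applied to combinations that do lie there: [N s'] times the inverse of [N s],
    whose lower left entry is minus the determinant of the bottom rows, and the conjugate of the
    unipotent generator by [N s], whose lower left entry is -c^2. *)
Lemma transv_rows (R : realType) (G : set 'M[R]_2) (q : nat)
    (kappa : nat -> option R) (sigma : nat -> 'M[R]_2) (j : nat) :
  fuchsian G -> complete_cusps G q kappa -> scaling_data G q kappa sigma ->
  (1 <= j <= q)%N ->
  let S := transv G (stab G kappa j) in
  let N (s : 'M[R]_2) := invmx (sigma j) *m s in
  [/\ (forall s s', S s -> S s' -> s != s' ->
         1 <= `|mc (N s) * md (N s') - mc (N s') * md (N s)|),
      (forall s, S s -> mc (N s) != 0 -> 1 <= `|mc (N s)|) &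
      (forall s, S s -> mc (N s) = 0 -> md (N s) ^+ 2 = 1)].
Proof.
move=> fG [q1 _ ineq _] [k1 st1 s1 sc] jq S N.
have [ds ks conj] := sc j jq.
have [Gdet [G1 _] GM GV _] := fG.
have [SG _] := transv_stabP R G kappa j fG.
have UG : G (mk2 1 1 0 1).
  have : stab G kappa 1 (mk2 1 1 0 1) by rewrite st1; exact: Ginf_unipotent.
  by case.
have cU : conj_group G (sigma j) (mk2 1 1 0 1).
  have : [set invmx (sigma j) *m A *m sigma j | A in stab G kappa j] (mk2 1 1 0 1).
    by rewrite conj; exact: Ginf_unipotent.
  by case=> A [GA _] <-; exists A.
have dS s : S s -> \det s = 1 by move=> /SG /Gdet.
have dN s : S s -> \det (N s) = 1 by move=> Ss; exact: (det_scaled R _ _ ds (dS _ Ss)).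
split.
- move=> s s' Ss Ss' ne.
  have GQ : G (s' *m invmx s) by apply: (GM _ _ (SG _ Ss')); exact/GV/SG.
  have Q := conj_quotient R (sigma j) s s' ds (dS _ Ss).
  have cE : mc (invmx (sigma j) *m (s' *m invmx s) *m sigma j) =
      - (mc (N s) * md (N s') - mc (N s') * md (N s)).
    rewrite Q mulmx_mc (invmx_ma _ _ (dN _ Ss)) (invmx_mc _ _ (dN _ Ss)) -!/(N _).
    by ring.
  rewrite -normrN -cE.
  apply: (conj_group_mc R G (sigma j) _ fG ds cU); first by exists (s' *m invmx s).
  apply/eqP => c0; move/eqP: ne; apply; apply: (transv_sep R G kappa j) => //.
  exact: (stab_of_conj R G kappa j (sigma j)).
- move=> s Ss c0.
  have [_ _ mcE _] := conj_unipotent R (N s) (dN _ Ss).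
  have : 1 <= `|mc (N s *m mk2 1 1 0 1 *m invmx (N s))|.
    apply: (conj_group_mc R G (sigma j) _ fG ds cU); last first.
      by rewrite mcE oppr_eq0 expf_neq0.
    exists (s *m mk2 1 1 0 1 *m invmx s).
      by apply: (GM _ _ (GM _ _ (SG _ Ss) UG)); exact/GV/SG.
    by rewrite (conj_quotient R _ _ _ ds (dS _ Ss)) /N !mulmxA.
  rewrite mcE normrN normrX; apply: contraTT; rewrite -!ltNge => lt1.
  by rewrite expr_lt1.
- move=> s Ss c0; have GS := SG _ Ss.
  (* With c = 0 the element [s] carries infinity to [kappa j]; inequivalence of the cusps gives [j]
     = 1, and [s] then lies in [Ginf], whose diagonal entries are 1 or -1. *)
  have sk : act_bd s None = kappa j.
    rewrite -ks (_ : s = sigma j *m N s); last by rewrite /N mulKVmx ?unitmx_det1.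
    by rewrite -(act_bd_comp R _ _ _ ds (dN _ Ss)) {2}/act_bd c0 eqxx.
  have j1 : 1%N = j.
    by apply: (ineq 1%N j) => //; rewrite ?q1 // k1; exists s.
  move: c0; rewrite /N -j1 s1 invmx1 mul1mx => c0.
  have : stab G kappa 1 s by split => //; rewrite k1 /act_bd c0 eqxx.
  rewrite st1 => -[b [] ->].
    by have [_ _ _ ->] := mk2E R 1 b%:~R 0 1; rewrite expr1n.
  by have [_ _ _ ->] := mk2E R (-1) (- b%:~R) 0 (-1); rewrite sqrrN expr1n.
Qed.

(** * Integrals of the automorphic sums *)

(** A sum over an infinite set defaults to 0 when infinitely many terms are nonzero; with at most
    one nonzero term it is the genuine sum. *)
Lemma fsbig_single (V : nmodType) (I : choiceType) (S : set I) (f : I -> V) :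
  (forall s s', S s -> S s' -> f s != 0 -> f s' != 0 -> s = s') ->
  \sum_(s \in S) f s = 0 \/
  exists s, [/\ S s, f s != 0 & \sum_(s \in S) f s = f s].
Proof.
move=> single; have [[s [Ss fs]]|nex] := pselect (exists s, S s /\ f s != 0).
  right; exists s; split => //.
  rewrite -(fsbig_widen [set s] S) ?fsbig_set1 //; first by move=> _ ->.
  move=> s' [Ss' /= ne]; apply/eqP/negP => /negP fs'.
  by apply: ne; apply: single.
left; apply: fsbig1 => s Ss; apply/eqP/negP => /negP fs.
by apply: nex; exists s.
Qed.

(* Lagrange's identity bounds the determinant of two bottom rows, so that at most one
   coset moves a given point above height [1]. *)
Lemma row_det_lt1 (R : realType) (c d c' d' x y t : R) : 0 < y -> 1 < t ->
  t * ((c * x + d) ^+ 2 + (c * y) ^+ 2) <= y ->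
  t * ((c' * x + d') ^+ 2 + (c' * y) ^+ 2) <= y ->
  `|c * d' - c' * d| < 1.
Proof.
move=> y0 t1.
set P := _ ^+ 2 + _; set Q := (c' * x + d') ^+ 2 + _ => hP hQ.
have t0 : 0 < t by lra.
have P0 : 0 <= P by rewrite addr_ge0 ?sqr_ge0.
have Q0 : 0 <= Q by rewrite addr_ge0 ?sqr_ge0.
have L : (y * (c * d' - c' * d)) ^+ 2 <= P * Q.
  have -> : P * Q = (y * (c * d' - c' * d)) ^+ 2 +
      ((c * x + d) * (c' * x + d') + (c * y) * (c' * y)) ^+ 2.
    by rewrite /P /Q; ring.
  by rewrite lerDl sqr_ge0.
have Py : P < y.
  by move: hP P0 y0 t1; clear; nra.
have Qy : Q < y.
  by move: hQ Q0 y0 t1; clear; nra.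
have : (y * (c * d' - c' * d)) ^+ 2 < y ^+ 2.
  by apply: (le_lt_trans L); rewrite expr2 ltr_pM.
rewrite exprMn -[X in _ < X]mulr1 ltr_pM2l ?exprn_gt0 //.
by rewrite -real_normK ?num_real // expr_lt1.
Qed.

(** Only the size of [u] and the height [t] of its support enter, so the same bound serves [f_T] and
    [g_T]. *)
Lemma eisen_integral_bound (R : realType) (G : set 'M[R]_2) (q : nat)
    (kappa : nat -> option R) (sigma : nat -> 'M[R]_2) (j : nat)
    (u : R[i] * R -> R[i]) (M t y al be : R) :
  fuchsian G -> complete_cusps G q kappa -> scaling_data G q kappa sigma ->
  (1 <= j <= q)%N ->
  0 <= M -> (forall p, `|complex.Re (u p)| <= M /\ `|complex.Im (u p)| <= M) ->
  (forall p, u p != 0 -> t <= complex.Im p.1) ->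
  1 < t -> 0 < y -> y < t -> al <= be ->
  let w := cint (fun x => eisen G kappa sigma j u (x +i* y, 0)) al be in
  `|complex.Re w| <= M * (2 / t * (be - al + 4)) /\
  `|complex.Im w| <= M * (2 / t * (be - al + 4)).
Proof.
move=> fG cc sd jq M0 uM ut t1 y0 yt albe w.
have [sep c1 c0] := transv_rows R G q kappa sigma j fG cc sd jq.
set S := transv G (stab G kappa j) in sep c1 c0.
pose N (s : 'M[R]_2) := invmx (sigma j) *m s.
have [_ _ _ sc] := sd; have [ds _ _] := sc j jq.
have [SG _] := transv_stabP R G kappa j fG; have [Gdet _ _ _ _] := fG.
have t0 : 0 < t by lra.
pose v x s := u (act1 (invmx (sigma j)) (act1 s (x +i* y, 0))).
have vt x s : S s -> v x s != 0 ->
    t <= y / ((mc (N s) * x + md (N s)) ^+ 2 + (mc (N s) * y) ^+ 2).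
  move=> Ss /ut; have dS := Gdet _ (SG _ Ss).
  rewrite [(act1 _ _).1](_ : _ = mob (invmx (sigma j)) (mob s (x +i* y))) //.
  by rewrite (mob_comp R _ _ _ _ dS y0) Im_mob // det_scaled.
(* If c = 0 then d^2 = 1, so the coset keeps the height [y] < [t], below the support of [u]. *)
have vc x s : S s -> v x s != 0 -> mc (N s) != 0.
  move=> Ss /(vt _ _ Ss) h; apply/eqP => e; move: h.
  by rewrite e !mul0r add0r expr0n addr0 (c0 _ Ss e) divr1 leNgt yt.
have single x s s' : S s -> S s' -> v x s != 0 -> v x s' != 0 -> s = s'.
  move=> Ss Ss' vs vs'; apply/eqP/negP => /negP ne.
  have := sep _ _ Ss Ss' ne; apply/negP; rewrite -ltNge.
  have gt0 r : S r -> 0 < (mc (N r) * x + md (N r)) ^+ 2 + (mc (N r) * y) ^+ 2.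
    by move=> Sr; apply: mob_den_gt0 => //; apply: det_scaled => //; exact/Gdet/SG.
  by apply: (row_det_lt1 R _ _ _ _ x y t) => //; rewrite -ler_pdivlMr ?vt ?gt0.
have [A [mA muA HA]] := farey_measure R _ S (fun s => mc (N s)) (fun s => md (N s)) y t al be
  sep c1 y0 t1 albe.
have alt x : (`[al, be]%classic : set R) x ->
    (complex.Re (eisen G kappa sigma j u (x +i* y, 0)) != 0 \/
     complex.Im (eisen G kappa sigma j u (x +i* y, 0)) != 0) -> A x.
  rewrite /= in_itv /= => xI.
  have [e|[s [Ss vs _]]] := fsbig_single _ _ S (v x) (single x).
    by rewrite /eisen -/S e /= eqxx => -[].
  by move=> _; apply: (HA x s) => //=; [exact: vc vs | exact: vt].
have bd x : `|complex.Re (eisen G kappa sigma j u (x +i* y, 0))| <= M /\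
    `|complex.Im (eisen G kappa sigma j u (x +i* y, 0))| <= M.
  have [e|[s [Ss vs e]]] := fsbig_single _ _ S (v x) (single x).
    by rewrite /eisen -/S e /= normr0.
  by rewrite /eisen -/S e; exact: uM.
split; apply: (Rintegral_bound R _ A) => //.
- by move=> x _; have [] := bd x.
- by move=> x xI ne; apply: alt => //; left.
- by move=> x _; have [] := bd x.
- by move=> x xI ne; apply: alt => //; right.
Qed.

Lemma cabs_sub_le (R : realType) (w w' : R[i]) (K : R) :
  `|complex.Re w| <= K -> `|complex.Im w| <= K ->
  `|complex.Re w'| <= K -> `|complex.Im w'| <= K -> cabs (w - w') <= 4 * K.
Proof.
case: w w' => [a b] [c d] /= ha hb hc hd.
apply: (@le_trans _ _ (`|a - c| + `|b - d|)).
  rewrite /cabs /= -[X in _ <= X]ger0_norm ?addr_ge0 // -sqrtr_sqr ler_wsqrtr //.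
  by rewrite [X in _ <= X]sqrrD !real_normK ?num_real // lerD2r lerDl mulrn_wge0 // mulr_ge0.
by have := ler_normB a c; have := ler_normB b d; lra.
Qed.

Lemma cint01_bound (R : realType) (f : R -> R[i]) (M : R) : 0 <= M ->
  (forall x, `|complex.Re (f x)| <= M /\ `|complex.Im (f x)| <= M) ->
  `|complex.Re (cint f 0 1)| <= M /\ `|complex.Im (cint f 0 1)| <= M.
Proof.
move=> M0 fM; rewrite -(mulr1 M).
have m1 : (lebesgue_measure (`[0%R, 1%R]%classic : set R) <= 1%:E)%E.
  by rewrite lebesgue_measure_itv /= lte_fin ltr01 -EFinB subr0.
by split; apply: (Rintegral_bound R _ `[0 : R, 1]%classic) => // x _; have [] := fM x.
Qed.

Lemma sind_mul_bound (R : realType) (T eta v M : R) (w : R[i]) :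
  `|complex.Re w| <= M /\ `|complex.Im w| <= M ->
  let K := (1 + 2 * `|(ell R)^-1|) * M in
  `|complex.Re ((sind T eta v)%:C * w)| <= K /\
  `|complex.Im ((sind T eta v)%:C * w)| <= K.
Proof.
case: w => a b /= [ha hb]; rewrite !mul0r subr0 addr0 !normrM.
by split; apply: ler_pM => //; exact: sind_bound.
Qed.

Lemma sind_mul_support (R : realType) (T eta v e : R) (w : R[i]) :
  `|eta| <= e -> (sind T eta v)%:C * w != 0 -> T - e <= v.
Proof.
move=> he; apply: contraNT; rewrite -ltNge => hv.
by rewrite sind_eq0 ?mul0r //; lra.
Qed.
Theorem theorem3p3 (R : realType) (G : set 'M[R]_2) (q : nat)
  (kappa : nat -> option R) (sigma : nat -> 'M[R]_2) (F : set (R * R))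
  (B0 B1 : R) (h : R -> R -> R[i]) :
  fuchsian G ->
  fund_domain G F ->
  (hyp_area F < +oo)%E ->
  F `<=` [set p | 0 <= p.1 <= 1 /\ 0 < p.2] ->
  complete_cusps G q kappa ->
  scaling_data G q kappa sigma ->
  1 < B0 -> B0 < B1 ->
  cusp_normalization F q sigma B0 ->
  smooth_torus_fun h ->
  forall j : nat, (1 <= j <= q)%N ->
  forall L : R, 0 < L ->
  exists C T0 : R, forall T eta eta' y delta alpha beta : R,
    T0 <= T -> B1 <= T ->
    `|eta| <= eta0 B0 B1 -> `|eta'| <= eta0 B0 B1 ->
    0 < y -> y < T - eta0 B0 B1 ->
    0 < delta <= 1 / 2 ->
    T `^ (- (3 / 4) + delta) < beta - alpha -> beta - alpha <= L ->
    cabs (cint (fun x => phi G kappa sigma h j T eta (x +i* y, 0)) alpha beta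
          - cint (fun x => varphi G kappa sigma h j T eta' (x +i* y, 0)) alpha beta)
    <= C * T `^ (- delta).
Proof.
move=> fG _ _ _ cc sd B01 B10 _ sh j jq L L0.
have [Mh Mh0 hM] := torus_fun_bounded R h sh.
pose M := (1 + 2 * `|(ell R)^-1|) * Mh.
have M0 : 0 <= M by rewrite mulr_ge0 // addr_ge0 // mulr_ge0.
(* The factor 16 is 4 from [cabs_sub_le] times 4 from 2/([T - e0]) <= 4/[T]; [L + 4] bounds the
   window length. *)
exists (16 * M * (L + 4)), 1 => T eta eta' y delta al be T1 BT he he' y0 yT.
move=> /andP[d0 d1] lenT lenL.
set e0 := eta0 B0 B1 in he he' yT *.
have e1 : e0 <= (B1 - B0) / 2 by rewrite /e0 /eta0 ge_min lexx.
have e2 : e0 <= 1 / 4 by rewrite /e0 /eta0 ge_min lexx orbT.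
(* Here [T - e0] is at least ([B0 + B1])/2, which exceeds 1. *)
have t1 : 1 < T - e0 by lra.
have albe : al <= be.
  by have := le_lt_trans (powR_ge0 _ _) lenT; rewrite subr_gt0 => /ltW.
have fb p : `|complex.Re (f_T h T eta p)| <= M /\ `|complex.Im (f_T h T eta p)| <= M.
  exact: sind_mul_bound.
have gb p : `|complex.Re (g_T h T eta' p)| <= M /\ `|complex.Im (g_T h T eta' p)| <= M.
  by apply: sind_mul_bound; apply: cint01_bound.
have fs p : f_T h T eta p != 0 -> T - e0 <= complex.Im p.1.
  exact: sind_mul_support.
have gs p : g_T h T eta' p != 0 -> T - e0 <= complex.Im p.1.
  exact: sind_mul_support.
have [f1 f2] := eisen_integral_bound R G q kappa sigma j _ M _ y al be
  fG cc sd jq M0 fb fs t1 y0 yT albe.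
have [g1 g2] := eisen_integral_bound R G q kappa sigma j _ M _ y al be
  fG cc sd jq M0 gb gs t1 y0 yT albe.
set K := M * _ in f1 f2 g1 g2.
have T0 : 0 < T by lra.
have tT : 2 / (T - e0) <= 4 * T^-1.
  rewrite ler_pdivrMr; last by lra.
  by rewrite mulrAC ler_pdivlMr //; lra.
have KT : 4 * K <= 16 * M * (L + 4) * T^-1.
  have -> : 16 * M * (L + 4) * T^-1 = 4 * (M * (4 * T^-1 * (L + 4))) by ring.
  rewrite ler_pM2l // /K ler_wpM2l //; apply: ler_pM => //; try lra.
  by rewrite divr_ge0 //; lra.
apply: (@le_trans _ _ (4 * K)); first exact: cabs_sub_le.
apply: (le_trans KT); rewrite -powR_inv1 ?(ltW T0) //.
apply: ler_wpM2l; first by apply: mulr_ge0; [exact: mulr_ge0 | lra].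
(* For [T] >= 1 the power grows with its exponent, and -1 <= -[delta]. *)
by apply: ler_powR => //; lra.
Qed.
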